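(* Let $R:V^{\otimes 2}\to V^{\otimes 2}$, $\dim V=N$, be the BMW symmetry coming from a quantum group $U_q(\mathfrak{g})$ with $\mathfrak{g}$ of orthogonal type ($B_n$ or $D_n$) or symplectic type ($C_n$), with $q$ generic. Let $(A,B)$ be the corresponding quantum double of Fock type, with $A=\mathrm{Sym}_R(V^* )$, $B=\mathrm{Sym}_R(V)$ in the orthogonal case and $A=\Lambda_R(V^* )$, $B=\Lambda_R(V)$ in the symplectic case. Let $L=\|l_i^j\|_{1\le i,j\le N}$ be the matrix with entries $l_i^j=x_ix^j$ in this double, where $x_i\in B$ and $x^j\in A$ are the generators. Then for all these series $$\mathcal{P}_{12}L_1R_{12}L_1-L_1R_{12}L_1\mathcal{P}_{12}=\mathcal{P}_{12}L_1-L_1\mathcal{P}_{12},\qquad L_1=L\otimes I,$$ where $\mathcal{P}=\mathcal{P}^{q}+\mathcal{P}^{\mu}$ for the orthogonal series and $\mathcal{P}=\mathcal{P}^{-q^{-1}}+\mathcal{P}^{\mu}$ for the symplectic one.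
   Context: Summation over repeated indices is understood; algebras are associative unital over $\mathbb{C}$. $V$ has basis $\{x_i\}_{1\le i\le N}$, $V^*$ has the right dual basis $\{x^i\}$ ($\langle x_i,x^j\rangle_r=\delta_i^j$), and $R(x_i\otimes x_j)=R_{ij}^{kl}x_k\otimes x_l$. **BMW symmetry.** $R$ is the composition of the usual flip $P$ with the image in $V^{\otimes 2}$ of the universal $R$-matrix of $U_q(\mathfrak{g})$, where $V$ is the first fundamental (vector) representation, with the Faddeev–Reshetikhin–Takhtajan normalization. Explicitly, $R=P\,\mathsf{R}$ with $$\mathsf{R}=q\sum_{i\ne i'}e_{ii}\otimes e_{ii}+\epsilon_0\,e_{mm}\otimes e_{mm}+\sum_{i\neq j,j'}e_{ii}\otimes e_{jj}+q^{-1}\sum_{i\ne i'}e_{i'i'}\otimes e_{ii}+(q-q^{-1})\sum_{i>j}e_{ij}\otimes e_{ji}-(q-q^{-1})\sum_{i>j}q^{\rho_i-\rho_j}\varepsilon_i\varepsilon_j\,e_{ij}\otimes e_{i'j'},$$ where $i'=N+1-i$; the term with $\epsilon_0=1$, $m=(N+1)/2$ is present only for $B_n$ ($\epsilon_0=0$ otherwise). For $B_n$: $N=2n+1$, $\rho=(n-\tfrac12,\dots,\tfrac12,0,-\tfrac12,\dots,-n+\tfrac12)$. For $C_n$: $N=2n$, $\rho=(n,\dots,1,-1,\dots,-n)$. For $D_n$: $N=2n$, $\rho=(n-1,\dots,1,0,0,-1,\dots,-n+1)$. All $\varepsilon_i=1$ for $B_n,D_n$; for $C_n$, $\varepsilon_i=1$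 if $i\le n$ and $\varepsilon_i=-1$ if $i>n$. In the sum $\sum_{i\ne j,j'}$ the indices are such that $i\ne j$ and $i\ne j'$. **Properties of $R$.** $R$ satisfies the braid relation $R_{12}R_{23}R_{12}=R_{23}R_{12}R_{23}$. It is skew-invertible: there is $\Psi$ with $R_{ij}^{kl}\Psi_{lm}^{jn}=\delta_m^k\delta_i^n$. It also satisfies $(R-qI)(R+q^{-1}I)(R-\mu I)=0$, with $\mu=q^{1-N}$ in the orthogonal case and $\mu=-q^{-1-N}$ in the symplectic case. **Idempotents.** $q\in\mathbb{C}\setminus\{0,\pm1\}$ is generic, so that $q,-q^{-1},\mu$ are pairwise distinct. $\mathcal{P}^{q},\mathcal{P}^{-q^{-1}},\mathcal{P}^{\mu}$ are the complementary idempotents (polynomials in $R$) with $\mathcal{P}^q+\mathcal{P}^{-q^{-1}}+\mathcal{P}^\mu=I$ and $R=q\mathcal{P}^q-q^{-1}\mathcal{P}^{-q^{-1}}+\mu\mathcal{P}^\mu$. On $(V^* )^{\otimes 2}$ they are given by the same polynomials in the operator $R(x^k\otimes x^l)=R_{ji}^{lk}\,x^i\otimes x^j$. **Algebras.** With $T(\cdot)$ the tensor algebra and $\langle J\rangle$ the two-sided ideal generated by $J$: - Orthogonal case: $\mathrm{Sym}_R(V)=T(V)/\langle\mathrm{Im}\,\mathcal{P}^{-q^{-1}}\rangle$ and $\mathrm{Sym}_R(V^* )=T(V^* )/\langle\mathrm{Im}\,\mathcal{P}^{-q^{-1}}\rangle$. - Symplectic case: $\Lambda_R(V)=T(V)/\langle\mathrm{Im}\,\mathcal{P}^{q}\rangle$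 and $\Lambda_R(V^* )=T(V^* )/\langle\mathrm{Im}\,\mathcal{P}^{q}\rangle$. In both cases the relations read $\mathcal{P}_{ij}^{kl}x_kx_l=x_ix_j$ and $x^lx^k\mathcal{P}_{kl}^{ij}=x^jx^i$. **Quantum double of Fock type.** $(A,B)$ is the associative unital algebra generated by $A$ and $B$ (with underlying space $B\otimes A$) subject to the permutation relations - $x^aR_{ai}^{bj}x_b=q^{-1}x_ix^j+\delta_i^j$ in the orthogonal case, - $x^aR_{ai}^{bj}x_b=-q\,x_ix^j+\delta_i^j$ in the symplectic case. **Matrix conventions.** Lower indices label rows and upper indices label columns: $(MN)_{ij}^{kl}=M_{ij}^{ab}N_{ab}^{kl}$, $(L_1)_{ij}^{kl}=l_i^k\delta_j^l$, $R_{12}=\|R_{ij}^{kl}\|$, $\mathcal{P}_{12}=\|\mathcal{P}_{ij}^{kl}\|$. Noncommuting entries are multiplied in the order of the matrices. *)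

(* Defs.v *)
From HB Require Import structures.
From mathcomp Require Import all_boot all_order all_algebra.
From mathcomp Require Import generic_quotient ring_quotient.
From mathcomp Require Import mxtens complex monalg.
From mathcomp Require Import boolp classical_sets reals.
From mathcomp Require Import ring.

Set Implicit Arguments.
Unset Strict Implicit.
Unset Printing Implicit Defensive.

Import GRing.Theory.

Local Open Scope classical_set_scope.
Local Open Scope ring_scope.
Local Open Scope quotient_scope.

Notation "A *t B" := (tensmx A B)
  (at level 40, left associativity, format "A  *t  B") : ring_scope.

Definition two_sided_ideal (A : pzRingType) (I : set A) : Prop :=
  [/\ I 0,
      forall x y, I x -> I y -> I (x - y),
      forall a x, I x -> I (a * x) &
      forall a x, I x -> I (x * a)].

Definition gen_ideal (A : pzRingType) (J : set A) : set A :=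
  [set x | forall I : set A, two_sided_ideal I -> J `<=` I -> I x].

Lemma gen_ideal_two_sided (A : pzRingType) (J : set A) :
  two_sided_ideal (gen_ideal J).
Proof.
split=> [I [] //|x y Ix Iy I idI JI|a x Ix I idI JI|a x Ix I idI JI].
- by case: (idI) => _ + _ _; apply; [apply: Ix | apply: Iy].
- by case: (idI) => _ _ + _; apply; apply: Ix.
- by case: (idI) => _ _ _; apply; apply: Ix.
Qed.

(* T(V) for V with basis X, realized as the algebra of the free monoid on X. *)
Notation free_alg K X := {malg K[{fmonom X}]}.

Definition fvar (K : fieldType) (X : choiceType) (x : X) : free_alg K X :=
  << fmu x >>%R.

Definition gen_idealb (A : pzRingType) (J : set A) : A -> bool :=
  fun x => `[< gen_ideal J x >].

Section Presented.
Variables (K : fieldType) (X : choiceType) (J : set (free_alg K X)).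

Local Notation F := (free_alg K X).

Fact gen_idealb_zmod : zmod_closed (gen_idealb J : {pred F}).
Proof.
have [I0 IB _ _] := gen_ideal_two_sided J.
by split=> [|x y /asboolP Ix /asboolP Iy]; apply/asboolP => //; apply: IB.
Qed.

HB.instance Definition _ :=
  GRing.isZmodClosed.Build F (gen_idealb J) gen_idealb_zmod.

(* The unital K-algebra with generators X and relators J. The library has
   ring quotients of commutative rings by proper ideals only, and its algebra
   structures require 1 != 0, so a presented algebra carries the joint
   pzRingType and lmodType structures, compatible by presented_scaleAl and
   presented_scaleAr. *)
Definition presented : Type := 
  Quotient.quot (GRing.ZmodClosed.clone F (gen_idealb J) _).

HB.instance Definition _ := GRing.Zmodule.on presented.
HB.instance Definition _ := EqQuotient.on presented.

Definition pres (x : F) : presented := \pi_presented x.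

Lemma presP (a : presented) : {x | a = pres x}.
Proof. by exists (repr a); rewrite /pres reprK. Qed.

Lemma pres_eqP (x y : F) : pres x = pres y <-> gen_ideal J (x - y).
Proof.
split=> [/eqP|xy]; last first.
  by apply/eqP; rewrite /pres -Quotient.idealrBE; apply/asboolP.
by rewrite /pres -Quotient.idealrBE => /asboolP.
Qed.

Lemma pres_repr (x : F) : gen_ideal J (repr (pres x) - x).
Proof. by apply/pres_eqP; rewrite /pres reprK. Qed.

Fact pres_is_additive : zmod_morphism pres.
Proof. by move=> x y; rewrite /pres !piE. Qed.

HB.instance Definition _ :=
  GRing.isZmodMorphism.Build F presented pres pres_is_additive.

Lemma gen_idealD (x y : F) :
  gen_ideal J x -> gen_ideal J y -> gen_ideal J (x + y).
Proof.
have [I0 IB _ _] := gen_ideal_two_sided J.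
move=> Ix Iy; rewrite -[y]opprK; apply: (IB) => //.
by rewrite -sub0r; apply: IB.
Qed.

Definition pres_one : presented := pres 1.
Definition pres_mul (a b : presented) : presented := pres (repr a * repr b).
Definition pres_scale (c : K) (a : presented) : presented :=
  pres (c *: repr a).

Fact pres_mulE (x y : F) : pres_mul (pres x) (pres y) = pres (x * y).
Proof.
have [_ _ Il Ir] := gen_ideal_two_sided J.
apply/pres_eqP; rewrite -[repr _ * _](subrK (x * repr (pres y))) -mulrBl.
rewrite -addrA -mulrBr; apply: gen_idealD.
  by apply: Ir; apply: pres_repr.
by apply: Il; apply: pres_repr.
Qed.

Fact pres_scaleE (c : K) (x : F) : pres_scale c (pres x) = pres (c *: x).
Proof.
have [_ _ Il _] := gen_ideal_two_sided J.
apply/pres_eqP; rewrite -scalerBr -[_ - _]mul1r scalerAl.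
by apply: Il; apply: pres_repr.
Qed.

Fact pres_mulA : associative pres_mul.
Proof.
move=> a b c; have [[[x ->] [y ->]] [z ->]] := (presP a, presP b, presP c).
by rewrite !pres_mulE mulrA.
Qed.

Fact pres_mul1 : left_id pres_one pres_mul.
Proof. by move=> a; have [x ->] := presP a; rewrite pres_mulE mul1r. Qed.

Fact pres_mulr1 : right_id pres_one pres_mul.
Proof. by move=> a; have [x ->] := presP a; rewrite pres_mulE mulr1. Qed.

Fact pres_mulDl : left_distributive pres_mul +%R.
Proof.
move=> a b c; have [[[x ->] [y ->]] [z ->]] := (presP a, presP b, presP c).
by rewrite -raddfD !pres_mulE -raddfD mulrDl.
Qed.

Fact pres_mulDr : right_distributive pres_mul +%R.
Proof.
move=> a b c; have [[[x ->] [y ->]] [z ->]] := (presP a, presP b, presP c).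
by rewrite -raddfD !pres_mulE -raddfD mulrDr.
Qed.

HB.instance Definition _ := GRing.Zmodule_isPzRing.Build presented
  pres_mulA pres_mul1 pres_mulr1 pres_mulDl pres_mulDr.

Fact pres_scaleA (c d : K) (a : presented) :
  pres_scale c (pres_scale d a) = pres_scale (c * d) a.
Proof. by have [x ->] := presP a; rewrite !pres_scaleE scalerA. Qed.

Fact pres_scale1 : left_id 1 pres_scale.
Proof. by move=> a; have [x ->] := presP a; rewrite pres_scaleE scale1r. Qed.

Fact pres_scaleDr : right_distributive pres_scale +%R.
Proof.
move=> c a b; have [[x ->] [y ->]] := (presP a, presP b).
by rewrite -raddfD !pres_scaleE -raddfD scalerDr.
Qed.

Fact pres_scaleDl (a : presented) : {morph pres_scale^~ a : c d / c + d}.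
Proof.
by move=> c d; have [x ->] := presP a; rewrite !pres_scaleE -raddfD scalerDl.
Qed.

HB.instance Definition _ := GRing.Zmodule_isLmodule.Build K presented
  pres_scaleA pres_scale1 pres_scaleDr pres_scaleDl.

Lemma presM (x y : F) : pres (x * y) = pres x * pres y.
Proof. by rewrite [RHS]pres_mulE. Qed.

Lemma pres1 : pres 1 = 1. Proof. by []. Qed.

Lemma presZ (c : K) (x : F) : pres (c *: x) = c *: pres x.
Proof. by rewrite [RHS]pres_scaleE. Qed.

Lemma presented_scaleAl (c : K) (a b : presented) :
  c *: (a * b) = (c *: a) * b.
Proof.
have [[x ->] [y ->]] := (presP a, presP b).
by rewrite -presM -!presZ -presM scalerAl.
Qed.

Lemma free_scaleAr (c : K) (x y : F) : c *: (x * y) = x * (c *: y).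
Proof.
apply/malgP=> k; rewrite mcoeffZ.
rewrite (mcoeffMlw _ (finmap.fsubset_refl _) (finmap.fsubset_refl _)).
rewrite (mcoeffMlw _ (finmap.fsubset_refl _) (msuppZ_le c y)).
rewrite mulr_sumr; apply: eq_bigr => k1 _.
rewrite mulr_sumr; apply: eq_bigr => k2 _.
by rewrite mcoeffZ !mulrnAr mulrCA.
Qed.

Lemma presented_scaleAr (c : K) (a b : presented) :
  c *: (a * b) = a * (c *: b).
Proof.
have [[x ->] [y ->]] := (presP a, presP b).
by rewrite -presM -!presZ -presM free_scaleAr.
Qed.

Definition gen (x : X) : presented := pres (fvar K x).

End Presented.

Section RMatrix.
Variable K : fieldType.

Variant series := Bn | Cn | Dn.

Definition vdim (t : series) (n : nat) : nat :=
  match t with Bn => n.*2.+1 | Cn | Dn => n.*2 end.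

(* 2 rho_i, with indices counted from 0. *)
Definition rho2 (t : series) (n : nat) (i : 'I_(vdim t n)) : int :=
  match t with
  | Bn => if (i < n)%N then 2 * n%:Z - 1 - 2 * i%:Z
          else if i == n :> nat then 0 else 2 * n%:Z + 1 - 2 * i%:Z
  | Cn => if (i < n)%N then 2 * n%:Z - 2 * i%:Z else 2 * n%:Z - 2 - 2 * i%:Z
  | Dn => if (i < n)%N then 2 * n%:Z - 2 - 2 * i%:Z else 2 * n%:Z - 2 * i%:Z
  end.

Definition eps (t : series) (n : nat) (i : 'I_(vdim t n)) : K :=
  match t with Cn => if (i < n)%N then 1 else - 1 | Bn | Dn => 1 end.

(* s is a square root of q: for B_n the numbers rho_i - rho_j may be
   half-integers. The i' of the mathematics is rev_ord i, and i = i' only for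
   the middle index of B_n. *)
Definition Rfrt (t : series) (n : nat) (q s : K) :
    'M[K]_(vdim t n * vdim t n) :=
  let e (i j : 'I_(vdim t n)) : 'M[K]_(vdim t n) := delta_mx i j in
  let pr (i : 'I_(vdim t n)) := rev_ord i in
  q *: (\sum_(i | i != pr i) e i i *t e i i)
  + \sum_(i | i == pr i) e i i *t e i i
  + \sum_(i < vdim t n) \sum_(j < vdim t n | (i != j) && (i != pr j))
      e i i *t e j j
  + q^-1 *: (\sum_(i | i != pr i) e (pr i) (pr i) *t e i i)
  + (q - q^-1) *: (\sum_(i < vdim t n) \sum_(j < vdim t n | (j < i)%N)
      e i j *t e j i)
  - (q - q^-1) *: (\sum_(i < vdim t n) \sum_(j < vdim t n | (j < i)%N)
      (s ^ (rho2 i - rho2 j) * eps i * eps j) *: (e i j *t e (pr i) (pr j))).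

Definition flip (N : nat) : 'M[K]_(N * N) :=
  \sum_(i < N) \sum_(j < N) delta_mx i j *t delta_mx j i.

(* The matrix units of Rfrt and flip act on column vectors, e_ij x_j = x_i,
   whereas in R_ij^kl the lower indices label the rows: hence the transpose.
   (This R is in fact symmetric.) *)
Definition Rmx (t : series) (n : nat) (q s : K) :
    'M[K]_(vdim t n * vdim t n) :=
  (flip (vdim t n) *m Rfrt t n q s)^T.

(* The operator x^k (x) x^l |-> R_ji^lk x^i (x) x^j, with row (k, l) and
   column (i, j). *)
Definition dual_op (N : nat) (M : 'M[K]_(N * N)) : 'M[K]_(N * N) :=
  \matrix_(u, v)
    M (mxtens_index ((mxtens_unindex v).2, (mxtens_unindex v).1))
      (mxtens_index ((mxtens_unindex u).2, (mxtens_unindex u).1)).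

Definition mu (t : series) (n : nat) (q : K) : K :=
  match t with
  | Cn => - q ^ (- 1 - (vdim t n)%:Z)
  | Bn | Dn => q ^ (1 - (vdim t n)%:Z)
  end.

Definition generic (t : series) (n : nat) (q : K) : Prop :=
  [/\ q != 0, q != 1, q != - 1 &
      [/\ q != - q^-1, q != mu t n q & - q^-1 != mu t n q]].

(* The spectral idempotent of X at a, when (X - a)(X - b)(X - c) = 0, as the
   Lagrange interpolation polynomial in X: see idem_at_sum, idem_at_spectral,
   idem_at_idem and idem_at_orth. *)
Definition idem_at (m : nat) (a b c : K) (X : 'M[K]_m) : 'M[K]_m :=
  ((a - b) * (a - c))^-1 *: ((X - b%:M) *m (X - c%:M)).

Section IdemTheory.
Variables (m : nat) (a b c : K) (X : 'M[K]_m).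
Hypotheses (ab : a != b) (ac : a != c) (bc : b != c).

Lemma idem_atE (x y z : K) : idem_at x y z X =
  ((x - y) * (x - z))^-1 *: (X *m X - (y + z) *: X + (y * z)%:M).
Proof.
congr (_ *: _); rewrite mulmxBl !mulmxBr mul_mx_scalar !mul_scalar_mx.
rewrite scale_scalar_mx scalerDl !opprD opprK !addrA.
by rewrite [_ - z *: X - _]addrAC.
Qed.

Lemma idem_at_sum :
  idem_at a b c X + idem_at b a c X + idem_at c a b X = 1%:M.
Proof.
rewrite !idem_atE; move: (X *m X) => Y; apply/matrixP=> i j.
rewrite !mxE; move: (Y i j) (X i j) => y x.
by case: (i == j); rewrite ?mulr1n ?mulr0n;
  field; rewrite !subr_eq0 ![b == a]eq_sym ![c == _]eq_sym ab ac bc.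
Qed.

Lemma idem_at_spectral :
  X = a *: idem_at a b c X + b *: idem_at b a c X + c *: idem_at c a b X.
Proof.
rewrite !idem_atE; move: (X *m X) => Y; apply/matrixP=> i j.
rewrite !mxE; move: (Y i j) (X i j) => y x.
by case: (i == j); rewrite ?mulr1n ?mulr0n;
  field; rewrite !subr_eq0 ![b == a]eq_sym ![c == _]eq_sym ab ac bc.
Qed.

Hypothesis cubic : (X - a%:M) *m (X - b%:M) *m (X - c%:M) = 0.

Lemma idem_at_eigen : X *m idem_at a b c X = a *: idem_at a b c X.
Proof.
apply/eqP; rewrite -subr_eq0 -mul_scalar_mx -mulmxBl /idem_at.
by rewrite -scalemxAr mulmxA cubic scaler0.
Qed.

Lemma idem_at_shift (x : K) :
  (X - x%:M) *m idem_at a b c X = (a - x) *: idem_at a b c X.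
Proof. by rewrite mulmxBl idem_at_eigen mul_scalar_mx -scalerBl. Qed.

Lemma idem_at_idem : idem_at a b c X *m idem_at a b c X = idem_at a b c X.
Proof.
rewrite {1}/idem_at -scalemxAl -mulmxA idem_at_shift -scalemxAr idem_at_shift.
have k1 : ((a - b) * (a - c))^-1 * (a - c) * (a - b) = 1.
  by field; rewrite !subr_eq0 ab ac.
by rewrite 2!scalerA k1 scale1r.
Qed.

Lemma idem_at_orth :
  [/\ idem_at b a c X *m idem_at a b c X = 0 &
      idem_at c a b X *m idem_at a b c X = 0].
Proof.
split; rewrite {1}/idem_at -scalemxAl -mulmxA idem_at_shift -scalemxAr.
  by rewrite idem_at_shift subrr scale0r !scaler0.
by rewrite idem_at_shift subrr scale0r !scaler0.
Qed.

End IdemTheory.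

Definition Pq (t : series) (n : nat) (q : K) (m : nat) (X : 'M[K]_m) :
    'M[K]_m :=
  idem_at q (- q^-1) (mu t n q) X.
Definition Pmq (t : series) (n : nat) (q : K) (m : nat) (X : 'M[K]_m) :
    'M[K]_m :=
  idem_at (- q^-1) q (mu t n q) X.
Definition Pmu (t : series) (n : nat) (q : K) (m : nat) (X : 'M[K]_m) :
    'M[K]_m :=
  idem_at (mu t n q) q (- q^-1) X.

(* The idempotent whose image is the space of quadratic relations. *)
Definition Prel (t : series) (n : nat) (q : K) (m : nat) (X : 'M[K]_m) :
    'M[K]_m :=
  match t with Cn => Pq t n q X | Bn | Dn => Pmq t n q X end.

Definition Pbmw (t : series) (n : nat) (q : K) (m : nat) (X : 'M[K]_m) :
    'M[K]_m :=
  match t with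
  | Cn => Pmq t n q X + Pmu t n q X
  | Bn | Dn => Pq t n q X + Pmu t n q X
  end.

(* u : 'rV_(N * N) holds the coordinates of an element of the tensor square in
   the basis x_i (x) x_j, and an operator acts on it by u |-> u *m M. *)
Definition quad (N : nat) (u : 'rV[K]_(N * N)) : free_alg K 'I_N :=
  \sum_(i < N) \sum_(j < N)
    u 0 (mxtens_index (i, j)) *: (fvar K i * fvar K j).

Definition im_quad (N : nat) (M : 'M[K]_(N * N)) : set (free_alg K 'I_N) :=
  [set quad (u *m M) | u in setT].

Definition relV (t : series) (n : nat) (q s : K) :
    set (free_alg K 'I_(vdim t n)) :=
  im_quad (Prel t n q (Rmx t n q s)).

Definition relVdual (t : series) (n : nat) (q s : K) :
    set (free_alg K 'I_(vdim t n)) :=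
  im_quad (Prel t n q (dual_op (Rmx t n q s))).

End RMatrix.

Arguments relV {K} t n q s.
Arguments relVdual {K} t n q s.

(* B: Sym_R(V) for B_n and D_n, Lambda_R(V) for C_n. *)
Notation algB t n q s := (presented (relV t n q s)).

(* A: Sym_R(V^* ) for B_n and D_n, Lambda_R(V^* ) for C_n. *)
Notation algA t n q s := (presented (relVdual t n q s)).

(* Relators forcing f : A -> F to become a morphism of unital K-algebras. *)
Inductive hom_rel (K : fieldType) (X : choiceType) (J : set (free_alg K X))
    (F : lalgType K) (f : presented J -> F) : set F :=
| hom_rel_1 : hom_rel f (f 1 - 1)
| hom_rel_mul (a b : presented J) : hom_rel f (f (a * b) - f a * f b)
| hom_rel_lin (c : K) (a b : presented J) :
    hom_rel f (f (c *: a + b) - (c *: f a + f b)).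

Section FockDouble.
Variables (K : fieldType) (t : series) (n : nat) (q s : K).

Local Notation N := (vdim t n).
Local Notation A := (algA t n q s).
Local Notation B := (algB t n q s).

(* The double is generated by the algebras A and B themselves: its generators
   are all elements of A and of B, hom_rel makes A and B map to it by algebra
   morphisms, and perm_rel gives the permutation relations. *)
Local Notation F := (free_alg K (A + B)%type).

Definition freeA (a : A) : F := fvar K (inl a).
Definition freeB (b : B) : F := fvar K (inr b).

Definition perm_const : K := match t with Cn => - q | Bn | Dn => q^-1 end.

Definition perm_rel : set F :=
  [set r | exists i j : 'I_N,
    r = \sum_(a < N) \sum_(b < N)
          Rmx t n q s (mxtens_index (a, i)) (mxtens_index (b, j))
            *: (freeA (gen _ a) * freeB (gen _ b))
        - (perm_const *: (freeB (gen _ i) * freeA (gen _ j))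
           + (i == j)%:R)].

Definition double_rel : set F :=
  hom_rel freeA `|` hom_rel freeB `|` perm_rel.

Definition fock_double : Type := presented double_rel.

HB.instance Definition _ := GRing.PzRing.on fock_double.
HB.instance Definition _ := GRing.Lmodule.on fock_double.

Definition inA (a : A) : fock_double := gen double_rel (inl a).
Definition inB (b : B) : fock_double := gen double_rel (inr b).

Definition xlow (i : 'I_N) : fock_double := inB (gen _ i).
Definition xup (j : 'I_N) : fock_double := inA (gen _ j).

Definition Lmx : 'M[fock_double]_N := \matrix_(i, j) (xlow i * xup j).

Definition to_double (m : nat) (M : 'M[K]_m) : 'M[fock_double]_m :=
  map_mx (fun c : K => c *: (1 : fock_double)) M.

End FockDouble.

Arguments perm_rel {K} t n q s.
Arguments double_rel {K} t n q s.

(* Main.v *)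
Require Import Defs.
From HB Require Import structures.
From mathcomp Require Import all_boot all_order all_algebra.
From mathcomp Require Import mxtens complex monalg classical_sets reals.

Set Implicit Arguments.
Unset Strict Implicit.
Unset Printing Implicit Defensive.

Import GRing.Theory.
Local Open Scope ring_scope.

(** In the product L_1 R_12 L_1, whose (i j, k l) entry is
    x_i x^a R_aj^bl x_b x^k, the two inner generators stand in the order
    A-generator, B-generator. The permutation relation swaps them:
<<
      (L_1 R_12 L_1)_ij^kl = c x_i x_j x^l x^k + x_i x^k delta_j^l,
>>
    where c is q^-1 or -q. The second term is the entry of L_1, and the first
    one is the entry of c times the product of the column (x_i x_j) by the row
    (x^l x^k) ([LRL_factor]).
    Now P fixes this column from the left ([Pbmw_low_pairs]) and this row from
    the right ([up_pairs_Pbmw]), so the quadratic term cancels in the commutator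
    with P, and P L_1 - L_1 P is left ([commutator_LRL]).

    That P fixes the column and the row is what the quadratic relations of the
    two algebras say: the three spectral idempotents of R sum to 1, so P is the
    complement of the idempotent whose image is the space of relations
    ([Pbmw_Prel]). On the dual space the relations come from the polynomial in
    [dual_op R]; since [dual_op] reverses products, it commutes with polynomials
    in one operator ([dual_op_idem]), and the relations are those of the same
    idempotent read along columns with both pairs of indices flipped. *)

(** * Products with a matrix on the first tensor factor *)

Lemma sum_mxtens (V : nmodType) (m n : nat) (F : 'I_(m * n) -> V) :
  \sum_k F k = \sum_(i < m) \sum_(j < n) F (mxtens_index (i, j)).
Proof.
rewrite pair_big /= (reindex (@mxtens_index m n)) /=.
  by apply: eq_bigr => -[i j].
exists (@mxtens_unindex m n) => k _.
  exact: mxtens_indexK.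
exact: mxtens_unindexK.
Qed.

Section TensorOne.
Variables (S : pzRingType) (m n p : nat) (A : 'M[S]_m).

Lemma mul_tens1E (M : 'M[S]_(m * n, p)) (i : 'I_m) (j : 'I_n) (k : 'I_p) :
  (A *t 1%:M *m M) (mxtens_index (i, j)) k
  = \sum_(a < m) A i a * M (mxtens_index (a, j)) k.
Proof.
rewrite mxE sum_mxtens; apply: eq_bigr => a _.
rewrite (bigD1 j) //= big1 => [|b bj]; rewrite tensmxE mxE.
  by rewrite eqxx mulr1 addr0.
by rewrite eq_sym (negPf bj) mulr0 mul0r.
Qed.

Lemma mul_mx_tens1E (M : 'M[S]_(p, m * n)) (i : 'I_p) (k : 'I_m) (l : 'I_n) :
  (M *m (A *t 1%:M)) i (mxtens_index (k, l))
  = \sum_(b < m) M i (mxtens_index (b, l)) * A b k.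
Proof.
rewrite mxE sum_mxtens; apply: eq_bigr => b _.
rewrite (bigD1 l) //= big1 => [|a al]; rewrite tensmxE mxE.
  by rewrite eqxx mulr1 addr0.
by rewrite (negPf al) !mulr0.
Qed.

End TensorOne.

(** * Reordering L R L over an arbitrary ring *)

Section Reordering.
Variables (S : pzRingType) (N : nat) (x y : 'I_N -> S).
Variables (R : 'M[S]_(N * N)) (c : S).

Local Notation L1 := ((\matrix_(i < N, j < N) (x i * y j)) *t (1%:M : 'M[S]_N)).

Definition low_pairs : 'cV[S]_(N * N) :=
  \col_u (x (mxtens_unindex u).1 * x (mxtens_unindex u).2).

(** The pair (k, l) gives y_l y_k: in L_1 R_12 L_1 the factor produced by the
    exchange, with index l, precedes the outer one, with index k. *)
Definition up_pairs : 'rV[S]_(N * N) :=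
  \row_u (y (mxtens_unindex u).2 * y (mxtens_unindex u).1).

(* Scalars are elements of S here, so that matrices of scalars and matrices of
   generators multiply; these commutations stand for their centrality. *)
Hypothesis yR : forall a u v, GRing.comm (y a) (R u v).
Hypothesis xc : forall i, GRing.comm (x i) c.
Hypothesis yx : forall i j,
  \sum_(a < N) \sum_(b < N)
    R (mxtens_index (a, i)) (mxtens_index (b, j)) * (y a * x b)
  = c * (x i * y j) + (i == j)%:R.

(** The quadratic part of the exchange relation separates the x from the y, and
    so gives a column times a row; its part (i == j) gives back L_1. *)
Lemma LRL_factor : L1 *m R *m L1 = low_pairs *m (c *: up_pairs) + L1.
Proof.
apply/matrixP=> u v.
case: (mxtens_indexP u) => i j; case: (mxtens_indexP v) => k l.
rewrite -mulmxA mul_tens1E.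
under eq_bigr => a _ do rewrite mul_mx_tens1E mxE.
(* Isolating y_a R x_b between the outer generators exposes the relation. *)
transitivity (x i * (\sum_(a < N) \sum_(b < N)
    R (mxtens_index (a, j)) (mxtens_index (b, l)) * (y a * x b)) * y k).
  rewrite mulr_sumr mulr_suml; apply: eq_bigr => a _.
  rewrite !mulr_sumr mulr_suml; apply: eq_bigr => b _.
  by rewrite mxE !mulrA -(mulrA (x i)) (yR a) !mulrA.
rewrite yx mulrDr mulrDl mxE; congr (_ + _).
  rewrite mxE big_ord1 !mxE !mxtens_indexK /=.
  by rewrite !mulrA -(mulrA (x i) (x j)) (xc j) !mulrA.
by rewrite tensmxE !mxE; case: eqP => _; rewrite ?mulr1 ?mulr0 ?mul0r.
Qed.

Lemma commutator_LRL (P : 'M[S]_(N * N)) :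
  P *m low_pairs = low_pairs -> up_pairs *m P = up_pairs ->
  P *m L1 *m R *m L1 - L1 *m R *m L1 *m P = P *m L1 - L1 *m P.
Proof.
move=> Plow upP; rewrite -!(mulmxA P) LRL_factor.
rewrite mulmxDr mulmxDl mulmxA Plow -(mulmxA low_pairs) -scalemxAl upP.
by rewrite [X in X - _]addrC addrKA.
Qed.

End Reordering.

(** * The spectral idempotents *)

Section DualOperator.
Variables (K : fieldType) (N : nat).
Implicit Types X Y : 'M[K]_(N * N).

Let flip_index (u : 'I_(N * N)) : 'I_(N * N) :=
  mxtens_index ((mxtens_unindex u).2, (mxtens_unindex u).1).

Let flip_indexK : involutive flip_index.
Proof. by move=> u; rewrite /flip_index mxtens_indexK mxtens_unindexK. Qed.

Lemma dual_opM X Y : dual_op (X *m Y) = dual_op Y *m dual_op X.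
Proof.
apply/matrixP=> u v; rewrite !mxE (reindex_inj (inv_inj flip_indexK)).
by apply: eq_bigr => w _; rewrite !mxE mulrC.
Qed.

(** A spectral idempotent is a polynomial in a single operator, so the reversal
    of products by [dual_op] is invisible to it. *)
Lemma dual_op_idem (a b c : K) X :
  idem_at a b c (dual_op X) = dual_op (idem_at a b c X).
Proof.
rewrite !idem_atE -dual_opM; apply/matrixP=> u v; rewrite !mxE.
by rewrite -!/(flip_index _) (inj_eq (inv_inj flip_indexK)) [v == u]eq_sym.
Qed.

Lemma Prel_dual_op (t : series) (n : nat) (q : K) X :
  Prel t n q (dual_op X) = dual_op (Prel t n q X).
Proof. by case: t; apply: dual_op_idem. Qed.

End DualOperator.

(** The relations span the image of one of three complementary idempotents;
    genericity makes the three eigenvalues distinct, as interpolation needs. *)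
Lemma Pbmw_Prel (K : fieldType) (t : series) (n : nat) (q : K) (m : nat)
    (X : 'M[K]_m) :
  generic t n q -> Pbmw t n q X = 1%:M - Prel t n q X.
Proof.
move=> [_ _ _ [qq qmu qqmu]]; rewrite -(idem_at_sum X qq qmu qqmu).
apply/esym/eqP; rewrite subr_eq; apply/eqP.
case: t qmu qqmu => qmu qqmu; rewrite /Pbmw /Prel /Pq /Pmq /Pmu.
- exact: addrAC.
- by rewrite -addrA addrC.
- exact: addrAC.
Qed.

(** * The quadratic relations in the double *)

Lemma pres_rel (K : fieldType) (X : choiceType) (J : set (free_alg K X))
    (r : free_alg K X) :
  J r -> pres J r = 0.
Proof.
move=> Jr; rewrite -(raddf0 (pres J)); apply/pres_eqP => I _; apply.
by rewrite subr0.
Qed.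

(** The image of M is spanned by its rows, so each row is a relation. *)
Lemma im_quad_rel (K : fieldType) (N : nat) (M : 'M[K]_(N * N))
    (J : set (free_alg K 'I_N)) (u : 'I_(N * N)) :
  (im_quad M `<=` J)%classic ->
  \sum_(i < N) \sum_(j < N)
    M u (mxtens_index (i, j)) *: (gen J i * gen J j) = 0.
Proof.
move=> MJ; have Mu : J (quad (row u M)).
  by apply: MJ; exists (delta_mx 0 u); [exact: I | rewrite -rowE].
rewrite -[RHS](pres_rel Mu) /quad raddf_sum; apply: eq_bigr => i _.
rewrite raddf_sum; apply: eq_bigr => j _.
by rewrite /= presZ presM mxE.
Qed.

Section FockDouble.
Variables (K : fieldType) (t : series) (n : nat) (q s : K).

Local Notation N := (vdim t n).
Local Notation D := (fock_double t n q s).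
Local Notation td := (to_double t n q s).
Local Notation R := (Rmx t n q s).
Local Notation ix i j := (mxtens_index (i, j)).
Local Notation x_ i := (xlow q s i).
Local Notation "x^ i" := (xup q s i) (at level 2).
Local Notation c := (perm_const t q).

(* These lemmas let the scalars of K act on the double as central elements of
   it, which is how they occur in the matrices [to_double]. *)
Lemma scale1_mull (k : K) (a : D) : k *: (1 : D) * a = k *: a.
Proof.
transitivity (k *: ((1 : D) * a)); last by rewrite mul1r.
exact/esym/presented_scaleAl.
Qed.

Lemma scale1_mulr (k : K) (a : D) : a * (k *: (1 : D)) = k *: a.
Proof.
transitivity (k *: (a * (1 : D))); last by rewrite mulr1.
exact/esym/presented_scaleAr.
Qed.

Lemma scale1_comm (k : K) (a : D) : GRing.comm a (k *: (1 : D)).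
Proof. by rewrite /GRing.comm scale1_mulr scale1_mull. Qed.

Fact inA_linear : linear (@inA K t n q s).
Proof.
move=> k a b; apply/eqP; rewrite -subr_eq0; apply/eqP.
have := @pres_rel _ _ (double_rel t n q s) _
  (or_introl (or_introl (hom_rel_lin (@freeA K t n q s) k a b))).
by rewrite raddfB raddfD /= presZ.
Qed.

HB.instance Definition _ := GRing.isLinear.Build K _ _ _ _ inA_linear.

Fact inB_linear : linear (@inB K t n q s).
Proof.
move=> k a b; apply/eqP; rewrite -subr_eq0; apply/eqP.
have := @pres_rel _ _ (double_rel t n q s) _
  (or_introl (or_intror (hom_rel_lin (@freeB K t n q s) k a b))).
by rewrite raddfB raddfD /= presZ.
Qed.

HB.instance Definition _ := GRing.isLinear.Build K _ _ _ _ inB_linear.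

Lemma inAZ (k : K) : {morph @inA K t n q s : a / k *: a}.
Proof. by move=> a; apply: linearZ_LR. Qed.

Lemma inAM : {morph @inA K t n q s : a b / a * b}.
Proof.
move=> a b; apply/eqP; rewrite -subr_eq0; apply/eqP.
have := @pres_rel _ _ (double_rel t n q s) _
  (or_introl (or_introl (hom_rel_mul (@freeA K t n q s) a b))).
by rewrite raddfB /= presM.
Qed.

Lemma inBZ (k : K) : {morph @inB K t n q s : a / k *: a}.
Proof. by move=> a; apply: linearZ_LR. Qed.

Lemma inBM : {morph @inB K t n q s : a b / a * b}.
Proof.
move=> a b; apply/eqP; rewrite -subr_eq0; apply/eqP.
have := @pres_rel _ _ (double_rel t n q s) _
  (or_introl (or_intror (hom_rel_mul (@freeB K t n q s) a b))).
by rewrite raddfB /= presM.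
Qed.

Lemma xlow_rel (u : 'I_(N * N)) :
  \sum_(i < N) \sum_(j < N) Prel t n q R u (ix i j) *: (x_ i * x_ j) = 0.
Proof.
rewrite -[RHS](raddf0 (@inB K t n q s)).
rewrite -[X in _ = _ X](im_quad_rel u (@subset_refl _ (relV t n q s))).
rewrite raddf_sum; apply: eq_bigr => i _.
rewrite raddf_sum; apply: eq_bigr => j _.
by rewrite [RHS]inBZ inBM.
Qed.

(** The relation of row (k, l) of the idempotent of [dual_op R], which is the
    column (l, k) of the idempotent of R, read with its row indices swapped. *)
Lemma xup_rel (k l : 'I_N) :
  \sum_(i < N) \sum_(j < N)
    Prel t n q R (ix j i) (ix l k) *: (x^ i * x^ j) = 0.
Proof.
rewrite -[RHS](raddf0 (@inA K t n q s)).
rewrite -[X in _ = _ X](im_quad_rel (ix k l)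
  (@subset_refl _ (relVdual t n q s))).
rewrite raddf_sum; apply: eq_bigr => i _.
rewrite raddf_sum; apply: eq_bigr => j _.
by rewrite [RHS]inAZ inAM Prel_dual_op mxE !mxtens_indexK.
Qed.

Lemma perm_relE (i j : 'I_N) :
  \sum_(a < N) \sum_(b < N) R (ix a i) (ix b j) *: (x^ a * x_ b)
  = c *: (x_ i * x^ j) + (i == j)%:R.
Proof.
apply/eqP; rewrite -subr_eq0; apply/eqP.
have := @pres_rel _ _ (double_rel t n q s) _
  (or_intror (ex_intro _ i (ex_intro _ j erefl))).
rewrite raddfB raddfD /= presZ presM (raddfMn (pres _)) => rel0.
rewrite -[RHS]rel0; congr (_ - _).
rewrite raddf_sum; apply: eq_bigr => a _.
rewrite raddf_sum; apply: eq_bigr => b _.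
by rewrite /= presZ presM.
Qed.

Lemma to_doubleB (m : nat) (M M' : 'M[K]_m) : td (M - M') = td M - td M'.
Proof. by apply/matrixP=> i j; rewrite !mxE scalerBl. Qed.

Lemma to_double1 (m : nat) : td (1%:M : 'M[K]_m) = 1%:M.
Proof.
by apply/matrixP=> i j; rewrite !mxE; case: eqP; rewrite ?scale1r ?scale0r.
Qed.

Lemma Pbmw_low_pairs :
  generic t n q ->
  td (Pbmw t n q R) *m low_pairs (@xlow K t n q s)
  = low_pairs (@xlow K t n q s).
Proof.
move=> q_gen; rewrite Pbmw_Prel // to_doubleB to_double1 mulmxBl mul1mx.
suff -> : td (Prel t n q R) *m low_pairs (@xlow K t n q s) = 0 by rewrite subr0.
apply/matrixP=> u z.
rewrite mxE [RHS]mxE -[RHS](xlow_rel u) sum_mxtens.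
apply: eq_bigr => i _; apply: eq_bigr => j _.
by rewrite !mxE mxtens_indexK scale1_mull.
Qed.

Lemma up_pairs_Pbmw :
  generic t n q ->
  up_pairs (@xup K t n q s) *m td (Pbmw t n q R) = up_pairs (@xup K t n q s).
Proof.
move=> q_gen; rewrite Pbmw_Prel // to_doubleB to_double1 mulmxBr mulmx1.
suff -> : up_pairs (@xup K t n q s) *m td (Prel t n q R) = 0 by rewrite subr0.
apply/matrixP=> z u.
case: (mxtens_indexP u) => l k.
rewrite mxE [RHS]mxE -[RHS](xup_rel k l) sum_mxtens exchange_big.
apply: eq_bigr => i _; apply: eq_bigr => j _.
by rewrite !mxE mxtens_indexK scale1_mulr.
Qed.

End FockDouble.

Theorem proposition8 (R : realType) (t : series) (n : nat) (q s : R[i])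
    (n_gt0 : (0 < n)%N) (s_sqrt : s ^+ 2 = q) (q_gen : generic t n q) :
  let R12 := to_double t n q s (Rmx t n q s) in
  let P12 := to_double t n q s (Pbmw t n q (Rmx t n q s)) in
  let L1 := Lmx t n q s *t 1%:M in
  P12 *m L1 *m R12 *m L1 - L1 *m R12 *m L1 *m P12 = P12 *m L1 - L1 *m P12.
Proof.
move=> R12 P12 L1; set D := fock_double t n q s.
apply: (@commutator_LRL D _ (@xlow _ t n q s) (@xup _ t n q s) R12
  (perm_const t q *: (1 : D)) _ _ _ P12).
- by move=> a u v; rewrite mxE; apply: scale1_comm.
- by move=> i; apply: scale1_comm.
- move=> i j; rewrite scale1_mull -perm_relE.
  apply: eq_bigr => a _; apply: eq_bigr => b _.
  by rewrite mxE scale1_mull.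
- exact: Pbmw_low_pairs.
- exact: up_pairs_Pbmw.
Qed.
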